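(* Let $\Gamma$ be a connected graph. Every visibility $\mathcal U$ on $\Gamma$ is pre-compact: for every $\mathbf u\in\mathcal U$ the vertex set $\Gamma^0$ is a union of finitely many $\mathbf u$-small sets.
   Context: Graphs are without loops and multiple edges; $\Gamma^0,\Gamma^1$ are the sets of vertices and edges of $\Gamma$; $\mathsf d$ is the graph metric. $\mathsf S^2M$ is the set of unordered pairs (repetition allowed) of elements of a set $M$, $\Delta^2M$ is the set of pairs $\{x,x\}$. For $\mathbf u\subset\mathsf S^2M$ containing $\Delta^2M$, $\mathbf u^2$ is the set of pairs $\{x,y\}$ such that $\{x,z\},\{z,y\}\in\mathbf u$ for some $z$. A uniformity on $M$ is a filter $\mathcal U$ of subsets of $\mathsf S^2M$ containing $\Delta^2M$ such that for every $\mathbf u\in\mathcal U$ there is $\mathbf v\in\mathcal U$ with $\mathbf v^2\subset\mathbf u$. A set $m\subset M$ is $\mathbf u$-small if all pairs of elements of $m$ belong to $\mathbf u$. For an edge $e\in\Gamma^1$ let $\mathbf u_e=\{\{x,y\}\in\mathsf S^2\Gamma^0:\mathsf d(x,e)+\mathsf d(y,e)\ge\mathsf d(x,y)\}$, where $\mathsf d(x,e)$ is the distance from $x$ to the set of endpoints of $e$; equivalently, no geodesic segment joining $x$ and $y$ passes through $e$. The visibility filter $\mathrm{Vis}\,\Gamma$ is the filter on $\mathsf S^2\Gamma^0$ generated by $\{\mathbf u_e:e\in\Gamma^1\}$. A visibility on $\Gamma$ is a uniformity $\mathcal U$ on $\Gamma^0$ with $\mathcal U\subset\mathrm{Vis}\,\Gamma$.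 *)

(* Defs.v *)
From mathcomp Require Import all_boot all_classical.

Set Implicit Arguments.
Unset Strict Implicit.
Unset Printing Implicit Defensive.

Local Open Scope classical_set_scope.

(* The unordered pair {x, y}, repetition allowed, is encoded as the subset
   [set x; y] of M. *)
Definition sym2 (M : Type) : Type :=
  {s : set M | exists x y, s = [set x; y]}.

Definition upair (M : Type) (x y : M) : sym2 M :=
  exist _ [set x; y] (ex_intro _ x (ex_intro _ y erefl)).

Definition diag2 (M : Type) : set (sym2 M) := [set upair x x | x in [set: M]].

Definition sym2_sqr (M : Type) (u : set (sym2 M)) : set (sym2 M) :=
  [set s | exists x y z, [/\ s = upair x y, u (upair x z) & u (upair z y)]].

Record uniformity (M : Type) (U : set_system (sym2 M)) : Prop := Uniformity {
  uniformity_filter : Filter U;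
  uniformity_diag : forall u, U u -> @diag2 M `<=` u;
  uniformity_sqr : forall u, U u -> exists2 v, U v & sym2_sqr v `<=` u
}.

Definition small (M : Type) (u : set (sym2 M)) (m : set M) : Prop :=
  forall x y, m x -> m y -> u (upair x y).

Definition pre_compact (M : Type) (U : set_system (sym2 M)) : Prop :=
  forall u, U u -> exists F : set (set M),
    [/\ finite_set F, forall m, F m -> small u m & \bigcup_(m in F) m = [set: M]].

(* The vertex set is arbitrary, possibly infinite; taking edges to be unordered
   pairs off the diagonal excludes loops and multiple edges. *)
Record graph : Type := Graph {
  vertex : Type;
  edge : set (sym2 vertex);
  edge_noloop : forall x, ~ edge (upair x x)
}.

Section GraphMetric.
Variable G : graph.

Definition adj : rel (vertex G) := fun x y => `[< edge (upair x y) >].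

Definition walk (x y : vertex G) (n : nat) : Prop :=
  exists p : seq (vertex G), [/\ path adj x p, last x p = y & size p = n].

Definition connected : Prop := forall x y : vertex G, exists n, walk x y n.

(* The minimum of A, with the junk value 0 when A is empty. *)
Definition least (A : set nat) : nat :=
  xget 0 [set n | A n /\ forall k, A k -> n <= k].

Definition dist (x y : vertex G) : nat := least [set n | walk x y n].

Definition dist_edge (x : vertex G) (e : sym2 (vertex G)) : nat :=
  least [set dist x a | a in sval e].

Definition u_edge (e : sym2 (vertex G)) : set (sym2 (vertex G)) :=
  [set s | exists x y,
     s = upair x y /\ dist x y <= dist_edge x e + dist_edge y e].

Definition Vis : set_system (sym2 (vertex G)) :=
  smallest (@Filter _) [set u_edge e | e in @edge G].

Definition visibility (U : set_system (sym2 (vertex G))) : Prop :=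
  uniformity U /\ U `<=` Vis.

End GraphMetric.

(* Main.v *)
Require Import Defs.
From mathcomp Require Import all_boot all_classical.

(** Fix an edge [e] with endpoints [a] and [b].  A geodesic through [e] runs
    from a vertex strictly closer to one endpoint to a vertex strictly closer
    to the other.  Hence two vertices having the same endpoint as a nearest
    point of [e] form a pair in [u_edge e], so that the two sets
    [d(x, a) <= d(x, b)] and [d(x, b) <= d(x, a)] cover the graph and are
    [u_edge e]-small ([fin_covered_u_edge]).

    The sets [u] for which finitely many [u]-small sets cover the vertices form
    a filter, because two finite covers have a finite common refinement by
    pairwise intersections ([fin_covered_filter]).  This filter contains the
    generators [u_edge e] of the visibility filter, hence the whole visibility
    filter, and a visibility is a part of the latter. *)

Set Implicit Arguments.
Unset Strict Implicit.
Unset Printing Implicit Defensive.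

Local Open Scope classical_set_scope.

Definition fin_covered (M : Type) (u : set (sym2 M)) : Prop :=
  exists F : set (set M),
    [/\ finite_set F, forall m, F m -> small u m & \bigcup_(m in F) m = [set: M]].

Lemma fin_covered_filter (M : Type) : Filter (@fin_covered M).
Proof.
split.
- exists [set setT]; split; [exact: finite_set1|by []|].
  by rewrite bigcup_set1.
- move=> u v [F [finF smF covF]] [H [finH smH covH]].
  exists [set m `&` n | m in F & n in H]; split.
  + exact: finite_image2.
  + move=> _ [m Fm [n Hn <-]] x y [mx nx] [my ny].
    by split; [exact: smF Fm _ _ mx my|exact: smH Hn _ _ nx ny].
  + apply/seteqP; split => // x _.
    have [m Fm mx] : (\bigcup_(m in F) m) x by rewrite covF.
    have [n Hn nx] : (\bigcup_(n in H) n) x by rewrite covH.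
    by exists (m `&` n) => //; exists m => //; exists n.
- move=> u v uv [F [finF smF covF]]; exists F; split => // m Fm x y mx my.
  exact/uv/(smF m).
Qed.

Lemma leastP (A : set nat) :
  A !=set0 -> A (least A) /\ forall k, A k -> least A <= k.
Proof.
move=> A0; rewrite /least.
suff [n An] : [set n | A n /\ forall k, A k -> n <= k] !=set0.
  by case: xgetP => [m _ //|none]; case: (none n).
have exA : exists n, `[< A n >] by case: A0 => k Ak; exists k; exact/asboolP.
case: (ex_minnP exA) => m /asboolP Am minm.
by exists m; split => // k Ak; exact/minm/asboolP.
Qed.

Lemma upairC (M : Type) (x y : M) : upair x y = upair y x.
Proof. by apply: eq_exist; exact: setUC. Qed.

Section GraphMetric.
Variable G : graph.
Implicit Types x y z a b : vertex G.

Lemma walk_sym x y n : walk x y n -> walk y x n.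
Proof.
move=> [p [adj_p <- <-]]; exists (rev (belast x p)); split.
- rewrite rev_path (@eq_path _ _ (@adj G)) // => v w.
  by rewrite /adj upairC.
- by case: p {adj_p} => //= v p; rewrite rev_cons last_rcons.
- by rewrite size_rev size_belast.
Qed.

Lemma walk_cat x y z m n : walk x y m -> walk y z n -> walk x z (m + n).
Proof.
move=> [p [adj_p py <-]] [q [adj_q qz <-]]; exists (p ++ q); split.
- by rewrite cat_path adj_p py.
- by rewrite last_cat py.
- by rewrite size_cat.
Qed.

Hypothesis Gconn : connected G.

Lemma dist_le x y n : walk x y n -> dist x y <= n.
Proof. by move=> w; have [_] := leastP (ex_intro _ n w); exact. Qed.

Lemma walk_dist x y : walk x y (dist x y).
Proof. by have [] := leastP (Gconn x y). Qed.

(** Both distances on the right are measured towards [a], as in the inequality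
    defining [u_edge]. *)
Lemma dist_le_add x y a : dist x y <= dist x a + dist y a.
Proof.
by apply: dist_le; apply: walk_cat (walk_dist x a) _; exact/walk_sym/walk_dist.
Qed.

Lemma dist_edge_upair x a b :
  dist x a <= dist x b -> dist_edge x (upair a b) = dist x a.
Proof.
move=> le_ab; rewrite /dist_edge.
have [|[c cab <-] min_e] := @leastP [set dist x c | c in sval (upair a b)].
  by exists (dist x a); exists a => //; left.
apply/eqP; rewrite eqn_leq; apply/andP; split.
- by apply: min_e; exists a => //; left.
- by case: cab => ->.
Qed.

(** When [a] is the endpoint nearest to both vertices, the inequality defining
    [u_edge] is the triangle inequality through [a]. *)
Lemma small_nearest a b :
  small (u_edge (upair a b)) [set x | dist x a <= dist x b].
Proof.
move=> x y xa ya; exists x, y; split => //.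
by rewrite !dist_edge_upair //; exact: dist_le_add.
Qed.

Lemma fin_covered_u_edge (e : sym2 (vertex G)) : fin_covered (u_edge e).
Proof.
have [a [b ->]] : exists a b, e = upair a b.
  by case: e => s [a [b sab]]; exists a, b; exact: eq_exist.
exists [set [set x | dist x a <= dist x b]; [set x | dist x b <= dist x a]].
split; first exact: finite_set2.
- move=> _ [->|->]; first exact: small_nearest.
  by rewrite upairC; exact: small_nearest.
- apply/seteqP; split => // x _.
  by case/orP: (leq_total (dist x a) (dist x b)) => le_x;
    [exists [set x | dist x a <= dist x b]|exists [set x | dist x b <= dist x a]];
    [left| |right|].
Qed.

Lemma fin_covered_Vis : @Vis G `<=` @fin_covered (vertex G).
Proof.
apply: smallest_sub; first exact: fin_covered_filter.
by move=> _ [e _ <-]; exact: fin_covered_u_edge.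
Qed.

End GraphMetric.

Theorem proposition4p1p1 (G : graph) (U : set_system (sym2 (vertex G))) :
  connected G -> visibility U -> pre_compact U.
Proof.
by move=> Gconn [_ UVis] u Uu; exact: (fin_covered_Vis Gconn (UVis _ Uu)).
Qed.
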